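(* Let $n>1$ be an integer, let $G\subseteq\mathbb{N}$ be an Abhyankar-Moh semigroup of degree $n$, and let $c$ be the conductor of $G$. Then $c\leq (n-1)(n-2)$. Moreover, if $\overline{b}_0=n,\overline{b}_1,\ldots,\overline{b}_h$ is the $n$-minimal sequence of generators of $G$ and $e_k=\gcd(\overline{b}_0,\ldots,\overline{b}_k)$ for $0\leq k\leq h$, then $c=(n-1)(n-2)$ if and only if $\overline{b}_k=\frac{n^2}{e_{k-1}}-e_k$ for all $k\in\{1,\ldots,h\}$.
   Context: $\mathbb{N}=\{0,1,2,\ldots\}$. A semigroup $G\subseteq\mathbb{N}$ is a subset containing $0$ and closed under addition; for integers $a_0,\ldots,a_k\geq 0$, $\mathbb{N}a_0+\cdots+\mathbb{N}a_k$ denotes the semigroup they generate. For an integer $n>0$ with $n\in G$, the $n$-minimal sequence of generators of $G$ is the (unique, finite) sequence $\overline{b}_0,\overline{b}_1,\ldots,\overline{b}_h$ with $\overline{b}_0=n$, $\overline{b}_k=\min\big(G\setminus(\mathbb{N}\overline{b}_0+\cdots+\mathbb{N}\overline{b}_{k-1})\big)$ for $1\leq k\leq h$, and $G=\mathbb{N}\overline{b}_0+\cdots+\mathbb{N}\overline{b}_h$. For $n>1$, a semigroup $G\subseteq\mathbb{N}$ with $n\in G$ is an Abhyankar-Moh semigroup of degree $n$ if its $n$-minimal sequence of generators $\overline{b}_0=n,\overline{b}_1,\ldots,\overline{b}_h$ satisfies: (G1) with $e_k=\gcd(\overline{b}_0,\ldots,\overline{b}_k)$ for $0\leq k\leq h$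 and $n_k=\frac{e_{k-1}}{e_k}$ for $1\leq k\leq h$, one has $e_h=1$ and $n_k>1$ for $1\leq k\leq h$ (so $h\geq 1$, since $n>1$); (G2) $n_{k-1}\overline{b}_{k-1}<\overline{b}_k$ for $2\leq k\leq h$; (G3) $e_{h-1}\overline{b}_h<n^2$. The conductor of $G$ is the smallest element $c\in G$ such that all integers $\geq c$ belong to $G$. *)

(* Defs.v *)
From mathcomp Require Import all_boot.

Set Implicit Arguments.
Unset Strict Implicit.
Unset Printing Implicit Defensive.

Definition semigroup (G : nat -> Prop) : Prop :=
  G 0 /\ forall x y, G x -> G y -> G (x + y).

(* N s_0 + ... + N s_k for s = [:: s_0; ...; s_k]. *)
Definition generated (s : seq nat) (x : nat) : Prop :=
  exists a : nat -> nat, x = \sum_(i < size s) a i * nth 0 s i.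

Definition is_min (P : nat -> Prop) (m : nat) : Prop :=
  P m /\ forall x, P x -> m <= x.

(* A sequence b_0, ..., b_h is the list [:: b_0; ...; b_h], of size h + 1. *)
Definition last_index (b : seq nat) : nat := (size b).-1.

(* For a given G this determines b, since each b_k is forced by its
   predecessors and the sequence stops exactly when it generates G. *)
Definition minimal_generators (n : nat) (G : nat -> Prop) (b : seq nat) : Prop :=
  [/\ 0 < size b,
      nth 0 b 0 = n,
      forall k, 1 <= k <= last_index b ->
        is_min (fun x => G x /\ ~ generated (take k b) x) (nth 0 b k)
    & forall x, G x <-> generated b x].

Definition gcd_upto (b : seq nat) (k : nat) : nat :=
  \big[gcdn/0]_(i < k.+1) nth 0 b i.

(* n_k = e_(k-1) / e_k for k >= 1; the division is exact. *)
Definition gcd_ratio (b : seq nat) (k : nat) : nat :=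
  gcd_upto b k.-1 %/ gcd_upto b k.

Definition AM_conditions (n : nat) (b : seq nat) : Prop :=
  let h := last_index b in
  [/\ gcd_upto b h = 1,
      forall k, 1 <= k <= h -> 1 < gcd_ratio b k,
      forall k, 2 <= k <= h ->
        gcd_ratio b k.-1 * nth 0 b k.-1 < nth 0 b k
    & gcd_upto b h.-1 * nth 0 b h < n ^ 2].

Definition abhyankar_moh (n : nat) (G : nat -> Prop) : Prop :=
  [/\ 1 < n,
      semigroup G,
      G n
    & exists b, minimal_generators n G b /\ AM_conditions n b].

Definition is_conductor (G : nat -> Prop) (c : nat) : Prop :=
  is_min (fun x => G x /\ forall m, x <= m -> G m) c.

(* Main.v *)
(* With S = \sum_(1 <= k <= h) (n_k - 1) b_k, the conductor is S - b_0 + 1.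
   Every residue class modulo b_0 has a representative \sum_k a_k b_k with
   0 <= a_k < n_k, which is at most S; hence everything above S - b_0 is in G.
   Conversely (G2) puts n_k b_k into N b_0 + ... + N b_(k-1), so elements of G
   can be rewritten with a_k < n_k for k >= 1; such coefficients are unique
   modulo b_0, which excludes S - b_0 from G.
   By (G2) the sequence e_(k-1) b_k increases, so (G3) bounds all its terms
   by n^2; divisibility by e_(k-1) e_k sharpens this to
   b_k <= n^2 / e_(k-1) - e_k. The sum S for these extremal values telescopes
   to (n - 1)^2. *)
Require Import Defs.
From mathcomp Require Import all_boot.
From mathcomp Require Import zify.

(** * Semigroups spanned by the first terms of a sequence *)

Definition span (b : nat -> nat) (k x : nat) : Prop :=
  exists a : nat -> nat, x = \sum_(i < k) a i * b i.

Lemma spanD b k x y : span b k x -> span b k y -> span b k (x + y).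
Proof.
case=> a -> [a' ->]; exists (fun i => a i + a' i).
by rewrite -big_split; apply: eq_bigr => i _; rewrite mulnDl.
Qed.

Lemma spanM b k m x : span b k x -> span b k (m * x).
Proof.
case=> a ->; exists (fun i => m * a i).
by rewrite big_distrr /=; apply: eq_bigr => i _; rewrite mulnA.
Qed.

Lemma spanS b k x :
  span b k.+1 x <-> exists y a, span b k y /\ x = y + a * b k.
Proof.
split=> [[a ->]|[y [m [[a ->] ->]]]].
  by exists (\sum_(i < k) a i * b i), (a k); split; [exists a | rewrite big_ord_recr].
exists (fun i => if i == k then m else a i).
rewrite big_ord_recr /= eqxx; congr (_ + _); apply: eq_bigr => i _.
by rewrite ltn_eqF.
Qed.

Lemma span1 b x : span b 1 x <-> b 0 %| x.
Proof.
split=> [[a ->]|/dvdnP[m ->]]; first by rewrite big_ord1 dvdn_mull.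
by exists (fun=> m); rewrite big_ord1.
Qed.

Lemma span_first b k m : span b k.+1 (m * b 0).
Proof.
elim: k => [|k IH]; first by apply/span1/dvdn_mull.
by apply/spanS; exists (m * b 0), 0; rewrite addn0.
Qed.

Lemma dvdn_span b d k x : (forall i, i < k -> d %| b i) -> span b k x -> d %| x.
Proof. by move=> db [a ->]; apply: dvdn_sum => i _; rewrite dvdn_mull ?db. Qed.

Lemma dvdn_ratio_mul m b : m %| m %/ gcdn m b * b.
Proof. by rewrite mulnC gcdnC muln_divCA_gcd dvdn_mulr. Qed.

(* The multiples of b modulo m are the multiples of gcd(m, b), and m / gcd(m, b)
   coefficients reach all of them. *)
Lemma modn_multiple m b x : 0 < m -> gcdn m b %| x ->
  exists2 a, a < m %/ gcdn m b & a * b = x %[mod m].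
Proof.
move=> m0 /dvdnP[q ->].
have d0 : 0 < gcdn m b by rewrite gcdn_gt0 m0.
have r0 : 0 < m %/ gcdn m b by rewrite divn_gt0 // dvdn_leq ?dvdn_gcdl.
have [u _ /dvdnP[v huv]] := Bezoutl b m0.
(* Bezout makes [gcdn m b + u * b] a multiple of [m], and the factor [m.-1] acts as -1 modulo
   [m]. *)
pose c := q * (m.-1 * u).
exists (c %% (m %/ gcdn m b)); first by rewrite ltn_pmod.
have -> : c %% (m %/ gcdn m b) * b = c * b %[mod m].
  have /dvdnP[w hw] := dvdn_ratio_mul m b.
  rewrite {2}(divn_eq c (m %/ gcdn m b)) mulnDl -mulnA hw mulnA.
  by rewrite modnMDl.
have -> : c * b = (q * (u * b)) * m.-1 by rewrite /c; nia.
apply/eqP; rewrite -(eqn_modDr (q * (u * b))) -mulnSr prednK //.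
by rewrite -mulnDr huv (mulnA q v) !modnMl.
Qed.

(** * Gcd ratios and representatives modulo [b 0] *)

Section Sequence.

Variable b : nat -> nat.

Definition gcds k := \big[gcdn/0]_(i < k.+1) b i.

(* Indices are shifted: ratio k is n_(k+1). *)
Definition ratio k := gcds k %/ gcds k.+1.

Definition weight k := \sum_(i < k) (ratio i).-1 * b i.+1.

Lemma gcdsS k : gcds k.+1 = gcdn (gcds k) (b k.+1).
Proof. by rewrite /gcds big_ord_recr. Qed.

Lemma gcds0 : gcds 0 = b 0.
Proof. by rewrite /gcds big_ord1. Qed.

Lemma dvdn_gcdsS k : gcds k.+1 %| gcds k.
Proof. by rewrite gcdsS dvdn_gcdl. Qed.

Lemma dvdn_gcds k i : i <= k -> gcds k %| b i.
Proof.
by move=> ik; rewrite /gcds (bigD1 (Ordinal (ik : i < k.+1))) //= dvdn_gcdl.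
Qed.

Lemma ratioK k : ratio k * gcds k.+1 = gcds k.
Proof. exact: divnK (dvdn_gcdsS k). Qed.

Lemma dvdn_weight k : gcds k %| weight k.
Proof. by apply: dvdn_sum => i _; rewrite dvdn_mull ?dvdn_gcds. Qed.

Lemma weightS k : weight k.+1 = weight k + (ratio k).-1 * b k.+1.
Proof. by rewrite /weight big_ord_recr. Qed.

Hypothesis b0 : 0 < b 0.

Lemma gcds_gt0 k : 0 < gcds k.
Proof. exact: dvdn_gt0 b0 (dvdn_gcds k 0 _). Qed.

Lemma ratio_gt0 k : 0 < ratio k.
Proof. by rewrite divn_gt0 ?gcds_gt0 // dvdn_leq ?gcds_gt0 ?dvdn_gcdsS. Qed.

(** By induction: removing a multiple of [b k.+1] with coefficient below [ratio k] leaves a residue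
    divisible by [gcds k]. *)
Lemma span_representative k x : gcds k %| x ->
  exists s, [/\ s <= weight k, span b k.+1 s & s = x %[mod b 0]].
Proof.
elim: k x => [|k IH] x dx.
  exists 0; split=> //; first by apply/span1/dvdn0.
  by rewrite mod0n; apply/esym/eqP; rewrite -gcds0.
have dx' : gcdn (gcds k) (b k.+1) %| x by rewrite -gcdsS.
have [a ar ax] := modn_multiple _ _ _ (gcds_gt0 k) dx'.
rewrite -gcdsS -/(ratio k) in ar.
(* Adding [(b 0).-1] copies of [a * b k.+1] subtracts one copy modulo [b 0]. *)
have [|s [sw ss sx]] := IH (x + (b 0).-1 * (a * b k.+1)).
  rewrite /dvdn -modnDml -ax modnDml -mulSn prednK //.
  by rewrite -/(dvdn _ _) dvdn_mulr ?dvdn_gcds.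
exists (s + a * b k.+1); split.
- by rewrite weightS leq_add // leq_mul2r -ltnS prednK ?ratio_gt0 // ar orbT.
- by apply/spanS; exists s, a.
- by rewrite -modnDml sx modnDml -addnA -mulSnr prednK // addnC mulnC modnMDl.
Qed.

Lemma span_large k x : gcds k %| x -> weight k < x + b 0 -> span b k.+1 x.
Proof.
move=> dx wx; have [s [sw ss sx]] := span_representative k x dx.
have sxle : s <= x.
  rewrite leqNgt; apply/negP => xs.
  have : b 0 %| s - x by rewrite -eqn_mod_dvd ?sx // ltnW.
  by move/dvdn_leq; lia.
have /dvdnP[m hm] : b 0 %| x - s by rewrite -eqn_mod_dvd ?sx.
by rewrite -(subnKC sxle) hm; apply/spanD/span_first.
Qed.

(** [ratio k] is coprime to the cofactor of [gcds k.+1] in [b k.+1]. *)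
Lemma gcds_dvd_mul k a : (gcds k %| a * b k.+1) = (ratio k %| a).
Proof.
have g0 := gcds_gt0 k.+1; have gk := gcds_gt0 k.
have /dvdnP[q hq] := dvdn_gcds k.+1 k.+1 (leqnn _).
rewrite hq mulnA -{1}ratioK dvdn_pmul2r // Gauss_dvdl //.
rewrite /coprime -(eqn_pmul2r g0) muln_gcdl ratioK -hq mul1n.
by rewrite gcdsS.
Qed.

(** * The conductor under (G2) *)

Section Growth.

Variable h : nat.
Hypothesis ratio_gt1 : forall k, k < h -> 1 < ratio k.
Hypothesis growth : forall k, k.+1 < h -> ratio k * b k.+1 < b k.+2.

(** Inductively [weight k.+1 <= ratio k * b k.+1], which is below [b k.+2]. *)
Lemma weight_le k : k < h -> weight k <= b k.+1.
Proof.
elim: k => [|k IH] kh; first by rewrite /weight big_ord0.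
rewrite weightS; have := IH (ltnW kh); have := growth k kh.
have := ratio_gt0 k; case: (ratio k) => // r _ /=; rewrite mulSn; lia.
Qed.

Lemma span_ratio_mul k : k < h -> span b k.+1 (ratio k * b k.+1).
Proof.
move=> kh; apply: span_large; first by rewrite gcds_dvd_mul.
have := weight_le k kh; have := ratio_gt0 k; nia.
Qed.

(** The last coefficient is reduced modulo [ratio k], the excess going to the earlier generators.
    Divisibility by [gcds k] forces the remainder to be [(ratio k).-1], which cancels and leaves the
    previous case. *)
Lemma weight_notin_span k x : k <= h -> span b k.+1 x -> x + b 0 <> weight k.
Proof.
elim: k x => [|k IH] x kh; first by rewrite /weight big_ord0; lia.
case/spanS=> y [a [sy ->]].
rewrite (divn_eq a (ratio k)) mulnDl addnA weightS.
set z := y + _; set a' := a %% _.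
have sz : span b k.+1 z.
  by apply: spanD => //; rewrite -mulnA; apply/spanM/span_ratio_mul.
have ar : a' < ratio k by rewrite ltn_pmod ?ratio_gt0.
have -> : (ratio k).-1 = (ratio k).-1 - a' + a' by lia.
rewrite mulnDl => hw.
have {}hw : z + b 0 = weight k + ((ratio k).-1 - a') * b k.+1 by lia.
have dz : gcds k %| z + b 0.
  rewrite dvdn_addr ?dvdn_gcds //; by apply: dvdn_span sz => i; rewrite ltnS; apply: dvdn_gcds.
rewrite hw dvdn_addr ?dvdn_weight // gcds_dvd_mul in dz.
have {}dz : (ratio k).-1 - a' = 0.
  by apply/eqP; move: dz; apply: contraTT; rewrite -lt0n => p; rewrite gtnNdvd //; lia.
by move: hw; rewrite dz mul0n addn0; exact: IH (ltnW kh) sz.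
Qed.

Hypothesis gcds_h : gcds h = 1.

Lemma conductor_weight c : is_conductor (span b h.+1) c -> c + b 0 = (weight h).+1.
Proof.
move=> [[_ cG] cmin].
have wb : b 0 <= (weight h).+1.
  (* A representative of the class of -1 is at least [(b 0).-1], so [(weight h).+1 - b 0] is not
     truncated. *)
  have [|s [sw _ sx]] := span_representative h (b 0).-1; first by rewrite gcds_h.
  by rewrite [RHS]modn_small ?prednK // in sx; have := leq_mod s (b 0); lia.
have large m : (weight h).+1 - b 0 <= m -> span b h.+1 m.
  by move=> hm; apply: span_large; [rewrite gcds_h | lia].
have cle := cmin _ (conj (large _ (leqnn _)) large).
have [] // : c = (weight h).+1 - b 0 \/ c < (weight h).+1 - b 0 by lia.
  by move=> ->; rewrite subnK.
move=> clt; have sG : span b h.+1 ((weight h) - b 0) by apply: cG; lia.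
by have := weight_notin_span h _ (leqnn h) sG; lia.
Qed.

(** * Extremal values under (G3) *)

Hypothesis last_bound : gcds h.-1 * b h < b 0 ^ 2.

Lemma gcds_mul_bound k : k < h -> gcds k * b k.+1 < b 0 ^ 2.
Proof.
(* Descending induction from [h.-1], where the bound is (G3) itself. *)
move=> kh; have [m hm] : exists m, k + m = h.-1 by exists (h.-1 - k); lia.
elim: m k kh hm => [|m IH] k kh hm.
  by move: last_bound; rewrite -hm addn0 (_ : h = k.+1) //; lia.
have k1h : k.+1 < h by lia.
apply: leq_trans (IH _ k1h _); last by lia.
rewrite ltnS -ratioK (mulnC (ratio k)) -mulnA leq_mul2l ltnW ?orbT //.
exact: growth.
Qed.

Definition extremal k := b 0 ^ 2 %/ gcds k - gcds k.+1.

(** Both [b k.+1] and [b 0 ^ 2 %/ gcds k] are multiples of [gcds k.+1], so a strict inequality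
    between them leaves a gap of at least [gcds k.+1]. *)
Lemma le_extremal k : k < h -> b k.+1 <= extremal k.
Proof.
move=> kh; have := gcds_mul_bound k kh; rewrite /extremal.
have := gcds_gt0 k; have := gcds_gt0 k.+1.
have /dvdnP[m hm] := dvdn_gcds k 0 isT.
have /dvdnP[q hq] := dvdn_gcds k.+1 k.+1 (leqnn _).
have -> : b 0 ^ 2 = m ^ 2 * gcds k * gcds k by rewrite hm; nia.
move=> d0 g0; rewrite mulnK // mulnC ltn_pmul2r //.
rewrite hq -(ratioK k) mulnA ltn_pmul2r //.
move: (m ^ 2 * ratio k) => p; nia.
Qed.

(** With n = [b 0] and e_i = [gcds i], the i-th term equals (n^2/e_(i+1) + e_(i+1)) - (n^2/e_i +
    e_i), and n^2/e_0 + e_0 = 2n. *)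
Lemma extremal_sum k :
  \sum_(i < k) (ratio i).-1 * extremal i + 2 * b 0 = b 0 ^ 2 %/ gcds k + gcds k.
Proof.
elim: k => [|k IH]; first by rewrite big_ord0 gcds0 mulnK //; lia.
rewrite big_ord_recr /= addnAC IH /extremal.
have := gcds_gt0 k; have d0 := gcds_gt0 k.+1; have := ratio_gt0 k.
have /dvdnP[m hm] := dvdn_gcds k 0 isT.
have m0 : 0 < m by move: b0; rewrite hm; case: m {hm}.
rewrite hm -(ratioK k); move: (gcds k.+1) (ratio k) d0 => d r d0 r0 g0.
have -> : (m * (r * d)) ^ 2 = (m ^ 2 * (r * d)) * (r * d) by nia.
rewrite mulnK // [X in X %/ d]mulnA mulnK //.
have p0 : 0 < m ^ 2 by rewrite expn_gt0 m0.
move: (m ^ 2) p0 => p p0; case: r r0 {g0} => // r _ /=.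
have -> : p * (r.+1 * d) - d = (p * r.+1).-1 * d by nia.
have : 0 < p * r.+1 by nia.
by case E: (p * r.+1) => [|s] //= _; nia.
Qed.

Lemma weight_leqif :
  weight h + 2 * b 0 <= b 0 ^ 2 + 1 ?= iff [forall i : 'I_h, b i.+1 == extremal i].
Proof.
have <- : \sum_(i < h) (ratio i).-1 * extremal i + 2 * b 0 = b 0 ^ 2 + 1.
  by rewrite extremal_sum gcds_h divn1.
have le : weight h <= \sum_(i < h) (ratio i).-1 * extremal i
    ?= iff [forall i : 'I_h, b i.+1 == extremal i].
  apply: leqif_sum => i _; split.
    by rewrite leq_mul2l le_extremal ?orbT.
  (* The factor [(ratio i).-1] is positive, so equality of the terms gives [b i.+1 = extremal i]. *)
  by rewrite eqn_pmul2l //; have := ratio_gt1 i (ltn_ord i); lia.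
by split; rewrite ?leq_add2r ?eqn_add2r le.
Qed.

End Growth.

End Sequence.

(** A further entry of [b'] would lie in [G] but outside what [b] generates, which is all of [G]. *)
Lemma minimal_generators_size n G b b' :
  minimal_generators n G b -> minimal_generators n G b' ->
  take (size b) b' = b -> size b' <= size b.
Proof.
move=> [sb _ _ gb] [sb' _ mb' _] tb; rewrite leqNgt; apply/negP => lt.
have [|[Gx []]] := mb' (size b); first by rewrite /last_index; lia.
by rewrite tb; apply/gb.
Qed.

(** While the prefixes agree, both next entries are minima of the same set. *)
Lemma minimal_generators_unique n G b b' :
  minimal_generators n G b -> minimal_generators n G b' -> b = b'.
Proof.
move=> H H'.
have pre k : k <= size b -> k <= size b' -> take k b = take k b'.
  elim: k => [|k IH] kb kb'; first by rewrite !take0.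
  have tk := IH (ltnW kb) (ltnW kb').
  rewrite (take_nth 0) // [RHS](take_nth 0) // tk; congr rcons.
  case: H H' => _ b0 mb _ [_ b0' mb' _].
  case: k {IH} kb kb' tk => [|k] kb kb' tk; first by rewrite b0 b0'.
  have [|P Pmin] := mb k.+1; first by rewrite /last_index; lia.
  have [|P' Pmin'] := mb' k.+1; first by rewrite /last_index; lia.
  by apply/eqP; rewrite eqn_leq Pmin ?tk ?Pmin' -?tk //; rewrite ?tk.
have [le|/ltnW le] := leqP (size b) (size b').
  have tb : take (size b) b' = b by rewrite -pre // take_size.
  by rewrite -tb take_oversize //; apply: minimal_generators_size H H' tb.
have tb : take (size b') b = b' by rewrite pre // take_size.
by rewrite -tb take_oversize //; apply: minimal_generators_size H' H tb.
Qed.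

Theorem theorem1 (n : nat) (hn : 1 < n) (G : nat -> Prop)
    (hG : abhyankar_moh n G) (c : nat) (hc : is_conductor G c) :
  c <= (n - 1) * (n - 2) /\
  forall b : seq nat, minimal_generators n G b ->
    (c = (n - 1) * (n - 2) <->
     forall k, 1 <= k <= last_index b ->
       nth 0 b k = n ^ 2 %/ gcd_upto b k.-1 - gcd_upto b k).
Proof.
case: hG => _ _ _ [b [hb [g1 g1' g2 g3]]].
have [sb bn _ genG] := hb.
set h := last_index b in g1 g1' g2 g3 *.
have sbE : size b = h.+1 by rewrite prednK.
have b0 : 0 < nth 0 b 0 by rewrite bn ltnW.
have r1 k : k < h -> 1 < ratio (nth 0 b) k by move=> kh; apply: (g1' k.+1).
have gr k : k.+1 < h -> ratio (nth 0 b) k * nth 0 b k.+1 < nth 0 b k.+2.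
  by move=> kh; apply: (g2 k.+2).
have G3 : gcds (nth 0 b) h.-1 * nth 0 b h < nth 0 b 0 ^ 2 by rewrite bn.
have spanG x : G x <-> span (nth 0 b) h.+1 x by rewrite -sbE; apply: genG.
have hc' : is_conductor (span (nth 0 b) h.+1) c.
  case: hc => [[Gc cG] cmin]; split; first by split=> [|m /cG ?]; apply/spanG.
  by move=> x [sx xG]; apply: cmin; split=> [|m /xG ?]; apply/spanG.
have cE := conductor_weight _ b0 h gr g1 c hc'.
have [wle weq] := weight_leqif _ b0 h r1 gr g1 G3.
rewrite bn in cE wle weq.
(* Together with [cE], this turns both claims on [c] into claims on [weight (nth 0 b) h + 2 * n]. *)
have sq : (n - 1) * (n - 2) + 3 * n = n ^ 2 + 2 by nia.
split; first by lia.
move=> b' hb'; rewrite -(minimal_generators_unique _ _ _ _ hb hb').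
have -> : c = (n - 1) * (n - 2) <-> weight (nth 0 b) h + 2 * n == n ^ 2 + 1 by lia.
rewrite weq; split=> [/forallP ext [|k] // kh | ext].
  by rewrite (eqP (ext (Ordinal (kh : k < h)))) /extremal bn.
by apply/forallP => i; rewrite (ext i.+1) ?ltn_ord // /extremal bn.
Qed.
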